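(* Let $\Omega\subset\mathbb M_d$ be a uniformly bounded matrix convex domain. Let $f\colon\Omega\to\Omega$ be an nc self-map and let $f^{\circ n}=f\circ\cdots\circ f$ ($n$ times) be the sequence of iterates of $f$. Suppose that a subsequence $f^{\circ n_k}$ ($n_1<n_2<\cdots$) converges to $g$ uniformly on compact subsets of each level. Then either $g(\Omega(n))\subset\partial\Omega(n)$ for every $n\in\mathbb N$, or there exist an nc analytic subvariety $\mathfrak V\subset\Omega$, an nc automorphism $\varphi\colon\mathfrak V\to\mathfrak V$ and an nc holomorphic retraction $\psi\colon\Omega\to\mathfrak V$ such that $g=\varphi\circ\psi$.
   Context: $\mathbb M_d=\bigsqcup_{n\ge1}M_n(\mathbb C)^d$; for $\Omega\subset\mathbb M_d$, $\Omega(n)=\Omega\cap M_n(\mathbb C)^d$. Operations on tuples are coordinatewise. A set is an nc set if it is closed under direct sums. A matrix convex domain is an nc set $\Omega$ with every $\Omega(n)$ open and with $V^*XV\in\Omega(m)$ for every $X\in\Omega(n)$ and every isometry $V\colon\mathbb C^m\to\mathbb C^n$. Uniformly bounded means the norms of elements are bounded over all levels. $\partial\Omega(n)$ is the boundary of $\Omega(n)$ in $M_n(\mathbb C)^d$. An nc map on an nc set $\Xi$ (into $\mathbb M_d$) is a map $f$ with $f(\Xi(n))\subset M_n(\mathbb C)^d$, $f(X\oplus Y)=f(X)\oplus f(Y)$, and $f(S^{-1}XS)=S^{-1}f(X)S$ whenever $X,S^{-1}XS\in\Xi(n)$, $S\in GL_n(\mathbb C)$. An nc analytic subvariety of $\Omega$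 is an nc subset $\mathfrak V\subset\Omega$ such that each $\mathfrak V(n)$ is an analytic subvariety of $\Omega(n)$. An nc automorphism of $\mathfrak V$ is a bijection $\mathfrak V\to\mathfrak V$ such that it and its inverse are level-wise holomorphic nc maps. An nc holomorphic retraction $\psi\colon\Omega\to\mathfrak V$ is an nc (level-wise holomorphic) map with $\psi(\Omega)=\mathfrak V$ and $\psi|_{\mathfrak V}=\mathrm{id}_{\mathfrak V}$. *)

(* Defs.v *)
From HB Require Import structures.
From mathcomp Require Import all_boot all_order all_algebra.
From mathcomp Require Import complex.
From mathcomp Require Import all_classical all_reals all_analysis.
Set Implicit Arguments.
Unset Strict Implicit.
Unset Printing Implicit Defensive.
Import Order.TTheory GRing.Theory Num.Theory.
Import numFieldNormedType.Exports.
Local Open Scope classical_set_scope.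
Local Open Scope ring_scope.
Local Open Scope complex_scope.
Local Open Scope sesquilinear_scope.

(* R[i] does not carry a topology by itself; as a numClosedFieldType it does,
   and matrices over it are normed modules over it, so that [differentiable]
   below is complex Frechet differentiability. *)
Definition cplx (R : realType) : numClosedFieldType := R[i].

(* A d-tuple of n x n complex matrices is stored as the d x (n * n) matrix whose
   k-th row lists the entries of the k-th coordinate. *)
Notation mtuple R d n := 'M[cplx R]_(d, (n * n)%N).

Section Tuples.
Variables (R : realType) (d : nat).
Local Notation C := (cplx R).

Definition coord n (X : mtuple R d n) (k : 'I_d) : 'M[C]_n := vec_mx (row k X).

Definition mktuple n (F : 'I_d -> 'M[C]_n) : mtuple R d n :=
  \matrix_k mxvec (F k).

Lemma mktupleK n (F : 'I_d -> 'M[C]_n) k : coord (mktuple F) k = F k.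
Proof. by rewrite /coord /mktuple rowK mxvecK. Qed.

Lemma coordK n (X : mtuple R d n) : mktuple (coord X) = X.
Proof. by apply/row_matrixP => k; rewrite rowK vec_mxK. Qed.

Definition dsum m n (X : mtuple R d m) (Y : mtuple R d n) : mtuple R d (m + n) :=
  mktuple (fun k => block_mx (coord X k) 0 0 (coord Y k)).

Definition similar n (S : 'M[C]_n) (X : mtuple R d n) : mtuple R d n :=
  mktuple (fun k => invmx S *m coord X k *m S).

Definition compress m n (V : 'M[C]_(n, m)) (X : mtuple R d n) : mtuple R d m :=
  mktuple (fun k => V ^t* *m coord X k *m V).

Definition isometry m n (V : 'M[C]_(n, m)) : Prop := V ^t* *m V = 1%:M.

Definition enorm n (v : 'cV[C]_n) : R := Num.sqrt (\sum_i Normc.normc (v i 0) ^+ 2).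

Definition opnorm n (A : 'M[C]_n) : R :=
  sup [set enorm (A *m v) | v in [set v : 'cV[C]_n | enorm v <= 1]].

(* The library norm on matrices is the entrywise maximum, which is not
   comparable with the operator norm uniformly in n. *)
Definition tuple_norm n (X : mtuple R d n) : R :=
  \big[Num.max/0]_(k < d) opnorm (coord X k).

End Tuples.

Section NoncommutativeSets.
Variables (R : realType) (d : nat).
Local Notation C := (cplx R).

(* A subset of the disjoint union over n >= 1 of the spaces of tuples is given
   by its levels; a spurious level 0 is present in the type, and [nc_set] below
   requires it to be empty. *)
Definition nc_subset := forall n : nat, set (mtuple R d n).

(* A level-preserving map; only its values on the nc set at hand matter. *)
Definition nc_fun := forall n : nat, mtuple R d n -> mtuple R d n.

Implicit Types (Om V : nc_subset) (f g : nc_fun).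

Definition nc_set Om : Prop :=
  Om 0%N = set0 /\
  forall m n (X : mtuple R d m) (Y : mtuple R d n),
    Om m X -> Om n Y -> Om (m + n)%N (dsum X Y).

Definition matrix_convex_domain Om : Prop :=
  [/\ nc_set Om,
      forall n, open (Om n) &
      forall m n (V : 'M[C]_(n, m)) (X : mtuple R d n),
        (0 < m)%N -> isometry V -> Om n X -> Om m (compress V X)].

Definition uniformly_bounded Om : Prop :=
  exists M : R, forall n (X : mtuple R d n), Om n X -> tuple_norm X <= M.

Definition boundary (T : topologicalType) (A : set T) : set T :=
  closure A `\` interior A.

Definition nc_map Om f : Prop :=
  (forall m n (X : mtuple R d m) (Y : mtuple R d n),
     Om m X -> Om n Y -> f (m + n)%N (dsum X Y) = dsum (f m X) (f n Y)) /\
  (forall n (S : 'M[C]_n) (X : mtuple R d n),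
     S \in unitmx -> Om n X -> Om n (similar S X) ->
     f n (similar S X) = similar S (f n X)).

Definition holomorphic (E F : normedModType C) (U : set E) (h : E -> F) : Prop :=
  forall x, U x -> differentiable h x.

(* Holomorphy on a set that need not be open, in particular on an analytic
   subvariety: locally a restriction of an ambient holomorphic map. *)
Definition holomorphic_on (E F : normedModType C) (A : set E) (h : E -> F) : Prop :=
  forall p, A p -> exists (U : set E) (H : E -> F),
    [/\ open U, U p, holomorphic U H & forall x, U x -> A x -> H x = h x].

(* Near every point of W (not only of A, so that A is relatively closed in W),
   A is the common zero set of finitely many holomorphic functions, here the
   r components of h. *)
Definition analytic_subvariety (E : normedModType C) (W A : set E) : Prop :=
  A `<=` W /\
  forall p, W p -> exists (U : set E) (r : nat) (h : E -> 'rV[C]_r),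
    [/\ open U, U p, U `<=` W, holomorphic U h &
        A `&` U = U `&` [set x | h x = 0]].

Definition nc_analytic_subvariety Om V : Prop :=
  nc_set V /\ forall n, analytic_subvariety (Om n) (V n).

Definition nc_automorphism V (phi : nc_fun) : Prop :=
  exists phi' : nc_fun,
    [/\ forall n, set_bij (V n) (V n) (phi n),
        forall n X, V n X -> V n (phi' n X) /\ phi n (phi' n X) = X,
        nc_map V phi /\ (forall n, holomorphic_on (V n) (phi n)) &
        nc_map V phi' /\ (forall n, holomorphic_on (V n) (phi' n))].

Definition nc_retraction Om V (psi : nc_fun) : Prop :=
  [/\ nc_map Om psi,
      forall n, holomorphic (Om n) (psi n),
      forall n, psi n @` Om n = V n &
      forall n X, V n X -> psi n X = X].

End NoncommutativeSets.

(* Main.v *)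
(** An nc self-map [F] of [Om] satisfies
      [F [[X, X G - G Y], [0, Y]] = [[F X, F X G - G F Y], [0, F Y]]],
    the two block matrices being similar to direct sums. This one identity
    replaces all of complex analysis.  With [G] a large scalar it bounds the
    Lipschitz constant of [F] near a point in terms of [Om] alone, and the
    upper right corner of [F [[X, H], [0, X]]], linear in [H], is the Frechet
    derivative, so that bounded nc maps are holomorphic.  Compressing the
    identity by an isometry gives a Harnack-type estimate: if [F_k X] stays
    inside [Om] then so does [F_k Y], for any [Y] at any level; hence a
    pointwise limit of nc self-maps either takes values in the boundary only or
    is an nc self-map.

    If [g = lim f^(n_k)] is a self-map, take pointwise limits, along one
    ultrafilter, of [f^(m_k)] with [m_k = n_(s k) - n_k], giving [psi], and of
    [f^(m_k - n_k)], giving [h].  By the uniform Lipschitz bounds limits compose,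
    whence [psi o g = g = g o psi] and [g o h = h o g = psi].  So [psi] is a
    retraction onto [V = {X | psi X = X}], on which [g] is invertible with
    inverse [h], and [g = g o psi]. *)
Require Import Defs.
From HB Require Import structures.
From mathcomp Require Import all_boot all_order all_algebra.
From mathcomp Require Import complex.
From mathcomp Require Import all_classical all_reals all_analysis.
From mathcomp Require Import ring lra zify.
Set Implicit Arguments.
Unset Strict Implicit.
Unset Printing Implicit Defensive.
Import Order.TTheory GRing.Theory Num.Theory.
Import numFieldNormedType.Exports.
Local Open Scope classical_set_scope.
Local Open Scope ring_scope.

(** * Norms of matrices and tuples *)

Section MatrixNorm.
Local Open Scope complex_scope.
Variable R : realType.
Local Notation C := (cplx R).
Local Notation normc := (@Normc.normc R).

Lemma normc_ge0 (z : C) : 0 <= normc z.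
Proof. by case: z => a b; exact: sqrtr_ge0. Qed.

(** The library norm takes values in [C]; its real part puts every estimate in the ordered field
    [R]. *)
Definition nrm p q (A : 'M[C]_(p, q)) : R := complex.Re `|A|.

Lemma nrmE p q (A : 'M[C]_(p, q)) : `|A| = ((nrm A)%:C : C).
Proof. by apply/esym/(@RRe_real R); rewrite ger0_real// normr_ge0. Qed.

Lemma nrm_ge0 p q (A : 'M[C]_(p, q)) : 0 <= nrm A.
Proof. by rewrite -(@lecR R) -(nrmE A) normr_ge0. Qed.

Lemma nrm_leP p q (A : 'M[C]_(p, q)) (e : R) : 0 <= e ->
  (forall i j, normc (A i j) <= e) <-> nrm A <= e.
Proof.
move=> e0; rewrite -(@lecR R) -nrmE.
have e0C : (0 : C) <= e%:C by rewrite (@lecR R 0 e).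
split=> [Ae|Ae i j].
  have [E eE] : exists E : {nonneg C}, E%:num = (e%:C : C).
    by exists (NngNum e0C).
  rewrite -eE [leLHS]/Num.norm/= mx_normE num_le; apply/bigmax_leP; split=> //.
    by rewrite -num_le/= eE.
  by case=> i j _; rewrite -num_le/= eE; have := Ae i j; rewrite -(@lecR R).
have Aij : `|A i j| <= `|A| :> C.
  rewrite [leRHS]/Num.norm/= mx_normE -[leLHS]nngE num_le.
  exact: (le_bigmax _ _ (i, j)).
by have := le_trans Aij Ae; rewrite (@lecR R).
Qed.

Lemma entry_le_nrm p q (A : 'M[C]_(p, q)) i j : normc (A i j) <= nrm A.
Proof. by apply: (nrm_leP A (nrm_ge0 A)).2. Qed.

Lemma nrm0 p q : nrm (0 : 'M[C]_(p, q)) = 0.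
Proof. by rewrite /nrm normr0. Qed.

Lemma nrm0_eq0 p q (A : 'M[C]_(p, q)) : nrm A = 0 -> A = 0.
Proof. by move=> A0; apply/eqP; rewrite -normr_eq0 nrmE A0. Qed.

Lemma nrmN p q (A : 'M[C]_(p, q)) : nrm (- A) = nrm A.
Proof. by rewrite /nrm normrN. Qed.

Lemma nrmBC p q (A B : 'M[C]_(p, q)) : nrm (A - B) = nrm (B - A).
Proof. by rewrite -nrmN opprB. Qed.

Lemma nrmD p q (A B : 'M[C]_(p, q)) : nrm (A + B) <= nrm A + nrm B.
Proof. by rewrite -(@lecR R) rmorphD/= -!nrmE ler_normD. Qed.

Lemma nrmZ p q (z : C) (A : 'M[C]_(p, q)) : nrm (z *: A) = normc z * nrm A.
Proof.
by apply: (@complexI R); rewrite -(nrmE (z *: A)) normrZ nrmE rmorphM.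
Qed.

Lemma normc_real (t : R) : normc t%:C = `|t|.
Proof. by rewrite /= expr0n/= addr0 sqrtr_sqr. Qed.

Lemma nrmZr p q (t : R) (A : 'M[C]_(p, q)) : nrm ((t%:C : C) *: A) = `|t| * nrm A.
Proof. by rewrite nrmZ normc_real. Qed.

Lemma normc_sum (I : finType) (F : I -> C) :
  normc (\sum_i F i) <= \sum_i normc (F i).
Proof.
elim/big_ind2: _ => [|x u y v xu yv|//]; first by rewrite Normc.normc0.
exact: le_trans (le_normcD _ _) (lerD xu yv).
Qed.

Lemma nrmM p q s (A : 'M[C]_(p, q)) (B : 'M[C]_(q, s)) :
  nrm (A *m B) <= q%:R * nrm A * nrm B.
Proof.
apply/nrm_leP => [|i j]; first by rewrite !mulr_ge0 ?nrm_ge0.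
rewrite mxE; apply: le_trans (normc_sum _) _.
apply: (@le_trans _ _ (\sum_(k < q) nrm A * nrm B)).
  apply: ler_sum => k _; rewrite Normc.normcM.
  by rewrite ler_pM ?entry_le_nrm ?normc_ge0.
by rewrite sumr_const card_ord -mulrA mulr_natl.
Qed.

End MatrixNorm.

(** * Block upper triangular tuples and the operator norm *)

Section Tuples.
Local Open Scope complex_scope.
Local Open Scope sesquilinear_scope.
Variables (R : realType) (d : nat).
Local Notation C := (cplx R).
Local Notation normc := (@Normc.normc R).
(* [coord], [similar] and [mktuple] of [Defs] are shadowed by library names. *)
Local Notation coord := (@Defs.coord R d _).
Local Notation similar := (@Defs.similar R d _).
Local Notation mktuple := (@Defs.mktuple R d _).

Lemma coordD n (X Y : mtuple R d n) k : coord (X + Y) k = coord X k + coord Y k.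
Proof. by rewrite /coord !linearD. Qed.

Lemma coordB n (X Y : mtuple R d n) k : coord (X - Y) k = coord X k - coord Y k.
Proof. by rewrite /coord !linearB. Qed.

Lemma coordZ n z (X : mtuple R d n) k : coord (z *: X) k = z *: coord X k.
Proof. by rewrite /coord !linearZ. Qed.

Lemma eq_coord n (X Y : mtuple R d n) : coord X =1 coord Y -> X = Y.
Proof.
by move=> XY; apply/row_matrixP => k; apply: (can_inj vec_mxK); exact: XY.
Qed.

Lemma tuple_leP n (X : mtuple R d n) (e : R) : 0 <= e ->
  (forall k, nrm (coord X k) <= e) <-> nrm X <= e.
Proof.
move=> e0; split=> [Xe|/nrm_leP Xe k].
  apply/nrm_leP => // k l; case/mxvec_indexP: l => i j.
  by have /nrm_leP /(_ i j) := Xe k; rewrite !mxE; exact.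
by apply/nrm_leP => // i j; rewrite !mxE; exact: Xe.
Qed.

Lemma coord_le_nrm n (X : mtuple R d n) k : nrm (coord X k) <= nrm X.
Proof. exact: (tuple_leP X (nrm_ge0 X)).2. Qed.

Lemma nrm_blockP m1 m2 n1 n2 (A : 'M[C]_(m1, n1)) (B : 'M[C]_(m1, n2))
    (D : 'M[C]_(m2, n1)) (E : 'M[C]_(m2, n2)) (e : R) : 0 <= e ->
  [/\ nrm A <= e, nrm B <= e, nrm D <= e & nrm E <= e] <->
  nrm (block_mx A B D E) <= e.
Proof.
move=> e0.
split=> [[/nrm_leP Ae /nrm_leP Be /nrm_leP De /nrm_leP Ee]|/nrm_leP be].
  apply/nrm_leP => // i j.
  case: (fintype.split_ordP i) => i' ->; case: (fintype.split_ordP j) => j' ->.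
  - by rewrite block_mxEul; exact: Ae.
  - by rewrite block_mxEur; exact: Be.
  - by rewrite block_mxEdl; exact: De.
  - by rewrite block_mxEdr; exact: Ee.
split; apply/nrm_leP => // i j.
- by have := be e0 (lshift _ i) (lshift _ j); rewrite block_mxEul.
- by have := be e0 (lshift _ i) (rshift _ j); rewrite block_mxEur.
- by have := be e0 (rshift _ i) (lshift _ j); rewrite block_mxEdl.
- by have := be e0 (rshift _ i) (rshift _ j); rewrite block_mxEdr.
Qed.

(** The corner [H] is a family of rectangular matrices, since [mtuple] stores square ones only. *)
Definition utri m n (X : mtuple R d m) (H : 'I_d -> 'M[C]_(m, n))
  (Y : mtuple R d n) : mtuple R d (m + n) :=
  mktuple (fun k => block_mx (coord X k) (H k) 0 (coord Y k)).

Lemma coord_utri m n (X : mtuple R d m) (H : 'I_d -> 'M[C]_(m, n))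
    (Y : mtuple R d n) k :
  coord (utri X H Y) k = block_mx (coord X k) (H k) 0 (coord Y k).
Proof. exact: mktupleK. Qed.

Lemma eq_utri m n (X : mtuple R d m) (H H' : 'I_d -> 'M[C]_(m, n))
  (Y : mtuple R d n) : H =1 H' -> utri X H Y = utri X H' Y.
Proof. by move=> HH'; apply: eq_coord => k; rewrite !coord_utri HH'. Qed.

Lemma utri0 m n (X : mtuple R d m) (Y : mtuple R d n) :
  utri X (fun=> 0) Y = dsum X Y.
Proof. by []. Qed.

Lemma nrm_utriB m n (X X' : mtuple R d m) (H H' : 'I_d -> 'M[C]_(m, n))
    (Y Y' : mtuple R d n) (e : R) : 0 <= e -> nrm (X - X') <= e ->
  (forall k, nrm (H k - H' k) <= e) -> nrm (Y - Y') <= e ->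
  nrm (utri X H Y - utri X' H' Y') <= e.
Proof.
move=> e0 Xe He Ye; apply/tuple_leP => // k.
rewrite coordB !coord_utri opp_block_mx add_block_mx subr0.
apply/nrm_blockP => //; split; rewrite ?nrm0//.
- by rewrite -coordB (le_trans (coord_le_nrm _ _)).
- by rewrite -coordB (le_trans (coord_le_nrm _ _)).
Qed.

Definition urtuple m n (T : mtuple R d (m + n)) (k : 'I_d) : 'M[C]_(m, n) :=
  ursubmx (coord T k).

Lemma urtuple_utri m n (X : mtuple R d m) (H : 'I_d -> 'M[C]_(m, n))
    (Y : mtuple R d n) : urtuple (utri X H Y) =1 H.
Proof. by move=> k; rewrite /urtuple coord_utri block_mxKur. Qed.

Lemma nrm_urtuple m n (T : mtuple R d (m + n)) k : nrm (urtuple T k) <= nrm T.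
Proof.
apply: le_trans (coord_le_nrm T k).
have [|//] := (nrm_blockP (ulsubmx (coord T k)) (ursubmx (coord T k))
  (dlsubmx (coord T k)) (drsubmx (coord T k)) (nrm_ge0 (coord T k))).2.
by rewrite submxK.
Qed.

Lemma urtupleB m n (T T' : mtuple R d (m + n)) k :
  urtuple (T - T') k = urtuple T k - urtuple T' k.
Proof. by rewrite /urtuple coordB; apply/matrixP => i j; rewrite !mxE. Qed.

Lemma block1_unit m n (G : 'M[C]_(m, n)) :
  (block_mx 1%:M G 0 1%:M : 'M[C]_(m + n)) \in unitmx.
Proof. by rewrite unitmxE det_ublock !det1 mulr1 unitr1. Qed.

Lemma similar_utri m n (X : mtuple R d m) (Y : mtuple R d n)
    (G : 'M[C]_(m, n)) :
  similar (block_mx 1%:M G 0 1%:M) (dsum X Y) =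
  utri X (fun k => coord X k *m G - G *m coord Y k) Y.
Proof.
apply: eq_coord => k; rewrite coord_utri /similar !mktupleK.
(* Multiplying by the unipotent matrix on the left avoids computing its inverse: both sides become
   [[[X, X G], [0, Y]]]. *)
apply: (can_inj (mulKmx (block1_unit G))).
rewrite -!mulmxA mulKVmx ?block1_unit// !mulmx_block.
by rewrite !(mul1mx, mulmx1, mul0mx, mulmx0, addr0, add0r) subrK.
Qed.

Lemma enorm_ge0 n (v : 'cV[C]_n) : 0 <= enorm v.
Proof. exact: sqrtr_ge0. Qed.

Lemma entry_le_enorm n (v : 'cV[C]_n) i : normc (v i 0) <= enorm v.
Proof.
rewrite -[leLHS]ger0_norm ?normc_ge0// -sqrtr_sqr ler_wsqrtr//.
rewrite (bigD1 i)//= lerDl; apply: sumr_ge0 => j _; exact: sqr_ge0.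
Qed.

Lemma nrm_le_enorm n (v : 'cV[C]_n) : nrm v <= enorm v.
Proof.
by apply/nrm_leP => [|i j]; rewrite ?enorm_ge0// [j]ord1 entry_le_enorm.
Qed.

Lemma enorm_le_opnorm n (A : 'M[C]_n) (v : 'cV[C]_n) :
  enorm v <= 1 -> enorm (A *m v) <= opnorm A.
Proof.
move=> v1; apply: ub_le_sup; last by exists v.
(* [opnorm] is a [sup], so its set needs an upper bound; this crude one bounds each entry of
   [A *m w] by [n * nrm A]. *)
exists (Num.sqrt (\sum_(i < n) (n%:R * nrm A) ^+ 2)) => _ [w w1 <-].
rewrite ler_wsqrtr// ler_sum// => i _; rewrite lerXn2r ?nnegrE ?normc_ge0//.
  by rewrite mulr_ge0 ?nrm_ge0.
apply: le_trans (entry_le_nrm _ _ _) _; apply: le_trans (nrmM _ _) _.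
rewrite -[leRHS]mulr1 ler_wpM2l ?mulr_ge0 ?nrm_ge0//.
exact: le_trans (nrm_le_enorm w) w1.
Qed.

(** An entry is a component of the image of a basis vector. The constant is 1 at every level, so a
    bound uniform in [n] survives the passage to [nrm]. *)
Lemma nrm_le_opnorm n (A : 'M[C]_n) : nrm A <= opnorm A.
Proof.
have opA v : enorm v <= 1 -> enorm (A *m v) <= opnorm A.
  exact: enorm_le_opnorm.
have e0 : enorm (0 : 'cV[C]_n) = 0.
  by rewrite /enorm big1 ?sqrtr0// => i _; rewrite mxE Normc.normc0 expr0n.
apply/nrm_leP => [|i j].
  by apply: le_trans (enorm_ge0 _) (opA 0 _); rewrite e0.
have -> : A i j = (A *m delta_mx j 0 : 'cV[C]_n) i 0 by rewrite -colE mxE.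
apply: le_trans (entry_le_enorm _ _) (opA _ _).
rewrite /enorm (bigD1 j)//= big1 => [|l lj]; rewrite !mxE ?eqxx.
  by rewrite Normc.normc1 expr1n addr0 sqrtr1.
by rewrite (negPf lj) Normc.normc0 expr0n.
Qed.

Lemma nrm_le_tuple_norm n (X : mtuple R d n) : nrm X <= tuple_norm X.
Proof.
apply/tuple_leP => [|k]; first exact: bigmax_ge_id.
by apply: le_trans (nrm_le_opnorm _) _; exact: (le_bigmax _ _ k).
Qed.

Lemma uniformly_bounded_nrm (Om : nc_subset R d) : uniformly_bounded Om ->
  exists2 M : R, 0 <= M & forall n (X : mtuple R d n), Om n X -> nrm X <= M.
Proof.
case=> M OmM; exists (Num.max 0 M) => [|n X /OmM XM].
  by rewrite le_max lexx.
by rewrite le_max (le_trans (nrm_le_tuple_norm X) XM) orbT.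
Qed.

Lemma ball_nrm p q (X Y : 'M[C]_(p, q)) (r : R) :
  ball X (r%:C : C) Y <-> nrm (Y - X) < r.
Proof. by rewrite mx_norm_ball/= /ball_/= nrmE (@ltcR R) nrmBC. Qed.

Lemma nbhs_nrmP p q (X : 'M[C]_(p, q)) (A : set 'M[C]_(p, q)) :
  nbhs X A <-> exists2 r : R, 0 < r & forall Y, nrm (Y - X) < r -> A Y.
Proof.
split=> [/nbhs_ballP[e /= e0 XA]|[r r0 XA]]; last first.
  apply/nbhs_ballP; exists (r%:C : C) => /=; first by rewrite (@ltcR R 0 r).
  by move=> Y /ball_nrm/XA.
have er : (complex.Re e)%:C = e by apply/(@RRe_real R); rewrite gtr0_real.
exists (complex.Re e) => [|Y]; first by rewrite -(@ltcR R) er.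
by move=> /ball_nrm; rewrite er; exact: XA.
Qed.

Lemma open_nrm p q (A : set 'M[C]_(p, q)) X : open A -> A X ->
  exists2 r : R, 0 < r & forall Y, nrm (Y - X) < r -> A Y.
Proof. by rewrite openE => oA /oA /nbhs_nrmP. Qed.

End Tuples.

(** * Lipschitz bounds and derivatives of nc self-maps *)

Lemma differentiable_of_error (K : numFieldType) (V W : normedModType K)
    (h : V -> W) (x : V) (L : {linear V -> W}) : continuous L ->
  (forall e : K, 0 < e ->
    \forall y \near 0, `|h (x + y) - h x - L y| <= e * `|y|) ->
  differentiable h x.
Proof.
move=> Lc hL; have hLo : h \o shift x = cst (h x) + L +o_ 0 id.
  apply/eqaddoP => e e0; apply: filterS (hL e e0) => y /=.
  rewrite -[(_ - _) y]/(h (y + x) - (h x + L y)).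
  by rewrite opprD addrA (addrC x).
by apply/diff_locallyP; rewrite (diff_unique Lc hLo).
Qed.

Section SelfMaps.
Local Open Scope complex_scope.
Variables (R : realType) (d : nat).
Local Notation C := (cplx R).
Local Notation coord := (@Defs.coord R d _).
Local Notation similar := (@Defs.similar R d _).
Local Notation mktuple := (@Defs.mktuple R d _).
Variables (Om : nc_subset R d) (M : R).
Hypothesis Om_mcd : matrix_convex_domain Om.
Hypothesis M_ge0 : 0 <= M.
Hypothesis Om_le : forall n (X : mtuple R d n), Om X -> nrm X <= M.

Definition nc_selfmap (F : nc_fun R d) : Prop :=
  nc_map Om F /\ forall n, set_fun (Om (n := n)) (Om (n := n)) (F n).

Implicit Type F : nc_fun R d.

Lemma iter_selfmap F j : nc_selfmap F -> nc_selfmap (fun n => iter j (F n)).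
Proof.
move=> [[Fsum Fsim] FOm]; elim: j => [|j [[IHsum IHsim] IHOm]].
  by split; [split; reflexivity|move=> n X OmX; exact: OmX].
split; [split=> [m n X Y OmX OmY|n S X Su OmX OmSX]|move=> n X OmX] => /=.
- rewrite (IHsum _ _ _ _ OmX OmY).
  exact: Fsum (IHOm _ _ OmX) (IHOm _ _ OmY).
- rewrite (IHsim _ _ _ Su OmX OmSX).
  apply: (Fsim _ _ _ Su (IHOm _ _ OmX)).
  by rewrite -(IHsim _ _ _ Su OmX OmSX); exact: IHOm.
- exact/FOm/IHOm.
Qed.

Lemma dsum_in m n (X : mtuple R d m) (Y : mtuple R d n) :
  Om X -> Om Y -> Om (dsum X Y).
Proof. by case: Om_mcd => -[_ Osum] _ _; exact: Osum. Qed.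

Lemma Om_gt0 n (X : mtuple R d n) : Om X -> (0 < n)%N.
Proof.
by case: Om_mcd => -[Om0 _] _ _; case: n X => // X; rewrite Om0.
Qed.

Lemma ball_in n (X : mtuple R d n) : Om X ->
  exists2 r : R, 0 < r & forall Y, nrm (Y - X) < r -> Om Y.
Proof. by case: Om_mcd => _ Omo _ OmX; exact: open_nrm (Omo n) OmX. Qed.

(** A similarity may leave [Om], so membership of the triangular tuple is assumed; it will come from
    openness at [dsum X Y] when the corner is small. *)
Lemma selfmap_utri F m n (X : mtuple R d m) (Y : mtuple R d n)
    (G : 'M[C]_(m, n)) :
  nc_selfmap F -> Om X -> Om Y ->
  Om (utri X (fun k => coord X k *m G - G *m coord Y k) Y) ->
  F (m + n)%N (utri X (fun k => coord X k *m G - G *m coord Y k) Y) =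
  utri (F m X) (fun k => coord (F m X) k *m G - G *m coord (F n Y) k) (F n Y).
Proof.
move=> [[Fsum Fsim] _] OmX OmY; rewrite -!similar_utri => OmT.
by rewrite Fsim ?block1_unit ?Fsum//; exact: dsum_in.
Qed.

(** If [G] intertwines [X] and [Y], the triangular tuple is the direct sum itself, so the corner of
    its image vanishes. *)
Lemma selfmap_intertwine F m n (X : mtuple R d m) (Y : mtuple R d n)
    (G : 'M[C]_(m, n)) :
  nc_selfmap F -> Om X -> Om Y ->
  (forall k, coord X k *m G = G *m coord Y k) ->
  forall k, coord (F m X) k *m G = G *m coord (F n Y) k.
Proof.
move=> Fself OmX OmY XGY k; have [[Fsum _] _] := Fself.
have XYE : utri X (fun k => coord X k *m G - G *m coord Y k) Y = dsum X Y.
  by rewrite -utri0; apply: eq_utri => l; rewrite XGY subrr.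
have OmT : Om (utri X (fun k => coord X k *m G - G *m coord Y k) Y).
  by rewrite XYE; exact: dsum_in.
have := congr1 (fun T : mtuple R d (m + n) => urtuple T k)
  (selfmap_utri Fself OmX OmY OmT).
rewrite XYE (Fsum _ _ _ _ OmX OmY) -utri0 !urtuple_utri => /esym/eqP.
by rewrite subr_eq0 => /eqP.
Qed.

(** The matrix [A] plus the identity, as a block diagonal, intertwines the two triangular tuples;
    compare upper right blocks. Scalar [A] will give homogeneity of the derivative, row matrices its
    linearity. *)
Lemma selfmap_ur_natural F m m' n (X : mtuple R d m) (X' : mtuple R d m')
    (Y : mtuple R d n) (A : 'M[C]_(m, m')) H H' :
  nc_selfmap F -> Om (utri X H Y) -> Om (utri X' H' Y) ->
  (forall k, coord X k *m A = A *m coord X' k) ->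
  (forall k, H k = A *m H' k) ->
  forall k, urtuple (F (m + n)%N (utri X H Y)) k =
            A *m urtuple (F (m' + n)%N (utri X' H' Y)) k.
Proof.
move=> Fself OmT OmT' XA HA k.
have := @selfmap_intertwine F _ _ _ _ (block_mx A 0 0 1%:M) Fself OmT OmT' _ k.
rewrite -[coord (F _ (utri X H Y)) k]submxK.
rewrite -[coord (F _ (utri X' H' Y)) k]submxK !mulmx_block.
rewrite !(mulmx0, mul0mx, mulmx1, mul1mx, addr0, add0r).
move=> /(_ _)/eq_block_mx[] // l.
rewrite !coord_utri !mulmx_block.
by rewrite !(mulmx0, mul0mx, mulmx1, mul1mx, addr0, add0r) XA HA.
Qed.

(** The constants precede [F]: the bound is uniform over all self-maps, which makes limits compose
    later. *)
Lemma selfmap_lipschitz n (P : mtuple R d n) : Om P ->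
  exists r K : R, [/\ 0 < r, 0 <= K, forall Y, nrm (Y - P) < r -> Om Y &
    forall F, nc_selfmap F -> forall Y Z, nrm (Y - P) < r -> nrm (Z - P) < r ->
      nrm (F n Y - F n Z) <= K * nrm (Y - Z)].
Proof.
move=> OmP; have [s s0 sOm] := ball_in OmP.
have [r r0 rOm] := ball_in (dsum_in OmP OmP).
exists (Num.min s (r / 2)), (M / (r / 2)); split.
- by rewrite lt_min s0 divr_gt0.
- by rewrite !divr_ge0// ltW.
- by move=> Y; rewrite lt_min => /andP[/sOm].
move=> F Fself Y Z; rewrite !lt_min => /andP[/sOm OmY Yr] /andP[/sOm OmZ Zr].
have [YZ0|YZ0] := eqVneq (nrm (Y - Z)) 0.
  have /eqP := nrm0_eq0 YZ0; rewrite subr_eq0 => /eqP ->.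
  by rewrite !subrr !nrm0 mulr0.
have YZ_gt0 : 0 < nrm (Y - Z) by rewrite lt_neqAle eq_sym YZ0 nrm_ge0.
(* The corner [t (Y - Z)] then has norm [r / 2], while the corner [t (F Y - F Z)] of the image is
   bounded by [M]. *)
pose t := r / 2 / nrm (Y - Z); pose G : 'M[C]_n := (t%:C : C)%:M.
have t0 : 0 < t by rewrite !divr_gt0.
have GE (A B : mtuple R d n) k :
    coord A k *m G - G *m coord B k = (t%:C : C) *: coord (A - B) k.
  by rewrite mul_mx_scalar mul_scalar_mx coordB scalerBr.
have OmT : Om (utri Y (fun k => coord Y k *m G - G *m coord Z k) Z).
  apply: rOm; rewrite -utri0; apply: (@le_lt_trans _ _ (r / 2)); last lra.
  apply: nrm_utriB; rewrite ?(ltW Yr) ?(ltW Zr)//; first lra.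
  move=> k; rewrite subr0 GE nrmZr gtr0_norm// /t -[leRHS](divfK YZ0).
  by rewrite ler_wpM2l ?coord_le_nrm// ltW.
have FT : nrm (F _ (utri Y (fun k => coord Y k *m G - G *m coord Z k) Z)) <= M.
  by apply: Om_le; apply: Fself.2.
rewrite selfmap_utri// in FT.
have -> : M / (r / 2) * nrm (Y - Z) = M / t by rewrite /t; field; lra.
apply/tuple_leP => [|k]; first by rewrite divr_ge0// ltW.
rewrite ler_pdivlMr// mulrC; apply: le_trans FT.
apply: le_trans (nrm_urtuple _ k).
by rewrite urtuple_utri GE nrmZr gtr0_norm.
Qed.

(** * The derivative as an upper right corner *)

Section Derivative.
Variables (F : nc_fun R d) (n : nat) (X : mtuple R d n) (r : R).
Hypothesis Fself : nc_selfmap F.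
Hypothesis OmX : Om X.
Hypothesis r_gt0 : 0 < r.
Hypothesis r_ball2 : forall Y : mtuple R d (n + n),
  nrm (Y - dsum X X) <= r -> Om Y.
Hypothesis r_ball3 : forall Y : mtuple R d (n + n + n),
  nrm (Y - dsum (dsum X X) X) <= r -> Om Y.

(** A factor bringing tuples of norm at most [e] into the ball of radius [r]; the summand 1 keeps it
    positive and finite at [e = 0]. *)
Let damp (e : R) : R := r / (1 + e).

Let damp_gt0 e : 0 <= e -> 0 < damp e.
Proof. by move=> e0; rewrite divr_gt0// ltr_wpDr. Qed.

Let damp_le e e' : 0 <= e' -> e' <= e -> damp e * e' <= r.
Proof.
move=> e'0 e'e; have e0 := le_trans e'0 e'e.
rewrite /damp mulrAC ler_pdivrMr ?ltr_wpDr// ler_wpM2l ?ltW//; lra.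
Qed.

(* The bundle [utri X H X] lies in [Om] only for small [H], so [H] is first
   shrunk; the result does not depend on how much (see [nc_derivE]). *)
Definition nc_deriv (H : mtuple R d n) : mtuple R d n :=
  mktuple (fun k => ((damp (nrm H))^-1%:C : C) *:
    urtuple (F
      (utri X (fun k => (damp (nrm H))%:C *: coord H k) X)) k).

Lemma utri_scale_in (H : mtuple R d n) (c : R) : 0 <= c -> c * nrm H <= r ->
  Om (utri X (fun k => (c%:C : C) *: coord H k) X).
Proof.
move=> c0 cH; apply: r_ball2; rewrite -utri0.
apply: nrm_utriB; rewrite ?subrr ?nrm0 ?(ltW r_gt0)// => k.
rewrite subr0 nrmZr ger0_norm//; apply: le_trans cH.
by rewrite ler_wpM2l ?coord_le_nrm.
Qed.

(** Naturality for the scalar [c / a] compares the scale [c] with the scale [a] built into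
    [nc_deriv]. *)
Lemma nc_derivE (H : mtuple R d n) (c : R) k : 0 < c -> c * nrm H <= r ->
  urtuple (F (utri X (fun k => (c%:C : C) *: coord H k) X)) k =
  (c%:C : C) *: coord (nc_deriv H) k.
Proof.
move=> c0 cH; set a := damp (nrm H).
have a0 : 0 < a by rewrite damp_gt0 ?nrm_ge0.
have aH : a * nrm H <= r by rewrite damp_le ?nrm_ge0.
rewrite (@selfmap_ur_natural _ _ _ _ _ X X (((c / a)%:C : C)%:M)
  _ (fun k => (a%:C : C) *: coord H k) Fself).
- rewrite mul_scalar_mx /nc_deriv mktupleK scalerA; congr (_ *: _).
  by rewrite -rmorphM.
- exact: utri_scale_in (ltW c0) cH.
- exact: utri_scale_in (ltW a0) aH.
- by move=> l; rewrite scalar_mxC.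
- move=> l; rewrite mul_scalar_mx scalerA; congr (_ *: _).
  by rewrite -rmorphM divfK ?gt_eqF.
Qed.

(** The corners for [u], [v] and [z *: u + v] all come from one tuple over [dsum X X] with stacked
    corner [W], through the row intertwiners [[1 0]], [[0 1]] and [[z 1]]. *)
Lemma nc_deriv_linear : linear nc_deriv.
Proof.
(* [e] dominates the three norms, so one scale [c] serves all three tuples. *)
move=> z u v; pose e := nrm u + nrm v + nrm (z *: u + v).
have [u0 v0 w0] := And3 (nrm_ge0 u) (nrm_ge0 v) (nrm_ge0 (z *: u + v)).
have e0 : 0 <= e by rewrite /e; lra.
pose c := damp e; have c0 : 0 < c by exact: damp_gt0.
have cu : c * nrm u <= r by rewrite damp_le// /e; lra.
have cv : c * nrm v <= r by rewrite damp_le// /e; lra.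
have cw : c * nrm (z *: u + v) <= r by rewrite damp_le// /e; lra.
pose W k := col_mx ((c%:C : C) *: coord u k) ((c%:C : C) *: coord v k).
have OmW : Om (utri (dsum X X) W X).
  apply: r_ball3; rewrite -utri0.
  apply: nrm_utriB; rewrite ?subrr ?nrm0 ?(ltW r_gt0)// => k.
  rewrite subr0; apply/nrm_leP; rewrite ?(ltW r_gt0)// => i j.
  have cxr x : c * nrm x <= r -> nrm ((c%:C : C) *: coord x k) <= r.
    by apply: le_trans; rewrite nrmZr gtr0_norm// ler_pM2l// coord_le_nrm.
  case: (fintype.split_ordP i) => i' ->.
    by rewrite col_mxEu; apply: le_trans (entry_le_nrm _ _ _) (@cxr n u cu).
  by rewrite col_mxEd; apply: le_trans (entry_le_nrm _ _ _) (@cxr n v cv).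
have natW a b H : Om (utri X H X) ->
    (forall k, H k =
      a *: ((c%:C : C) *: coord u k) + b *: ((c%:C : C) *: coord v k)) ->
    forall k, urtuple (F (utri X H X)) k =
    row_mx a%:M b%:M *m urtuple (F (utri (dsum X X) W X)) k.
  move=> OmH HE; apply: (selfmap_ur_natural Fself OmH OmW) => k; last first.
    by rewrite HE mul_row_col !mul_scalar_mx.
  rewrite mktupleK mul_mx_row mul_row_block !(mulmx0, addr0, add0r).
  by rewrite !scalar_mxC.
have swap (A B : 'M[C]_n) : (c%:C : C) *: (z *: A + B) =
    z *: ((c%:C : C) *: A) + (c%:C : C) *: B.
  by rewrite scalerDr !scalerA (mulrC z).
have ru l : (c%:C : C) *: coord u l =
    1 *: ((c%:C : C) *: coord u l) + 0 *: ((c%:C : C) *: coord v l).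
  by rewrite scale1r scale0r addr0.
have rv l : (c%:C : C) *: coord v l =
    0 *: ((c%:C : C) *: coord u l) + 1 *: ((c%:C : C) *: coord v l).
  by rewrite scale1r scale0r add0r.
have rw l : (c%:C : C) *: coord (z *: u + v) l =
    z *: ((c%:C : C) *: coord u l) + 1 *: ((c%:C : C) *: coord v l).
  by rewrite coordD coordZ swap scale1r.
apply: eq_coord => k; rewrite coordD coordZ.
have EU := etrans (esym (nc_derivE k c0 cu))
  (natW 1 0 _ (utri_scale_in (ltW c0) cu) ru k).
have EV := etrans (esym (nc_derivE k c0 cv))
  (natW 0 1 _ (utri_scale_in (ltW c0) cv) rv k).
have EZ := etrans (esym (nc_derivE k c0 cw))
  (natW z 1 _ (utri_scale_in (ltW c0) cw) rw k).
move: (nc_deriv u) (nc_deriv v) (nc_deriv _) (urtuple _ k) EU EV EZ => U V Z T.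
rewrite -[T]vsubmxK !mul_row_col !mul_scalar_mx.
rewrite !(scale0r, scale1r, addr0, add0r) => EU EV EZ.
have c_neq0 : (c%:C : C) != 0 by rewrite (inj_eq (@complexI R)) gt_eqF.
by apply: (scalerI c_neq0); rewrite swap EZ EU EV.
Qed.

(** The term 1 comes from [damp]; a bound on the unit ball is all that continuity of a linear map
    asks for. *)
Lemma nc_deriv_bound (H : mtuple R d n) :
  nrm (nc_deriv H) <= M / r * (1 + nrm H).
Proof.
have c0 : 0 < damp (nrm H) by rewrite damp_gt0 ?nrm_ge0.
have cH : damp (nrm H) * nrm H <= r by rewrite damp_le ?nrm_ge0.
have -> : M / r * (1 + nrm H) = M / damp (nrm H).
  by rewrite /damp invf_div mulrA mulrAC.
apply/tuple_leP => [|k]; first by rewrite divr_ge0// ltW.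
rewrite ler_pdivlMr// mulrC -(gtr0_norm c0) -nrmZr -(nc_derivE k c0 cH).
apply: le_trans (nrm_urtuple _ k) _.
by apply: Om_le; apply: Fself.2; exact: utri_scale_in (ltW c0) cH.
Qed.

Variable K : R.
Hypothesis K_ge0 : 0 <= K.
Hypothesis r_ball1 : forall Y, nrm (Y - X) <= r -> Om Y.
Hypothesis K_lip : forall Y Z : mtuple R d (n + n),
  nrm (Y - dsum X X) <= r -> nrm (Z - dsum X X) <= r ->
  nrm (F Y - F Z) <= K * nrm (Y - Z).

(** [T1] and [T2] share the corner [t H] and differ only by [H] in the lower right block. Their
    images have corners [t (F (X + H) - F X)] and [t] times the derivative, so the Lipschitz bound
    at level [n + n] controls the error, with [t = r / nrm H]. *)
Lemma nc_deriv_error (H : mtuple R d n) : nrm H <= r ->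
  nrm (F (X + H) - F X - nc_deriv H) <= K / r * nrm H ^+ 2.
Proof.
move=> Hr; have [H0|H_neq0] := eqVneq (nrm H) 0.
  have -> : H = 0 by exact: nrm0_eq0.
  have -> : nc_deriv 0 = 0.
    have := nc_deriv_linear 1 0 0; rewrite !scale1r addr0.
    by rewrite -[LHS]addr0 => /addrI.
  by rewrite addr0 subrr subr0 nrm0 expr0n mulr0.
have H_gt0 : 0 < nrm H by rewrite lt_neqAle eq_sym H_neq0 nrm_ge0.
pose t := r / nrm H; have t0 : 0 < t by rewrite divr_gt0.
have tH : t * nrm H = r by rewrite divfK.
have tHk k : nrm ((t%:C : C) *: coord H k) <= r.
  rewrite nrmZr gtr0_norm// -tH ler_wpM2l ?coord_le_nrm//; exact: ltW.
have XHX : X + H - X = H by rewrite addrC addKr.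
have OmXH : Om (X + H) by apply: r_ball1; rewrite XHX.
pose G : 'M[C]_n := ((- t)%:C : C)%:M.
have GE (A B : mtuple R d n) k :
    coord A k *m G - G *m coord B k = (t%:C : C) *: coord (B - A) k.
  rewrite mul_mx_scalar mul_scalar_mx coordB rmorphN/= !scaleNr scalerBr.
  by rewrite opprK addrC.
pose T1 := utri X (fun k => coord X k *m G - G *m coord (X + H) k) (X + H).
pose T2 := utri X (fun k => (t%:C : C) *: coord H k) X.
have T1r : nrm (T1 - dsum X X) <= r.
  rewrite -utri0; apply: nrm_utriB; rewrite ?subrr ?nrm0 ?(ltW r_gt0)//.
    by move=> k; rewrite subr0 GE XHX.
  by rewrite XHX.
have T2r : nrm (T2 - dsum X X) <= r.
  rewrite -utri0; apply: nrm_utriB; rewrite ?subrr ?nrm0 ?(ltW r_gt0)//.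
  by move=> k; rewrite subr0.
have T12 : nrm (T1 - T2) <= nrm H.
  apply: nrm_utriB; rewrite ?subrr ?nrm0 ?(ltW H_gt0)//.
    by move=> k; rewrite GE XHX subrr nrm0 nrm_ge0.
  by rewrite XHX.
have FT1 k : urtuple (F T1) k = (t%:C : C) *: coord (F (X + H) - F X) k.
  rewrite /T1 (selfmap_utri Fself OmX OmXH); last exact: r_ball2.
  by rewrite urtuple_utri GE.
have FT2 k : urtuple (F T2) k = (t%:C : C) *: coord (nc_deriv H) k.
  by apply: nc_derivE => //; rewrite tH.
apply/tuple_leP => [|k]; first by rewrite mulr_ge0 ?divr_ge0 ?sqr_ge0// ltW.
have -> : K / r * nrm H ^+ 2 = K * nrm H / t by rewrite /t; field; lra.
rewrite ler_pdivlMr// mulrC -(gtr0_norm t0) -nrmZr coordB scalerBr -FT1 -FT2.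
rewrite -urtupleB; apply: le_trans (nrm_urtuple _ k) _.
by apply: le_trans (K_lip T1r T2r) _; exact: ler_wpM2l.
Qed.

End Derivative.

Lemma selfmap_differentiable F n (X : mtuple R d n) :
  nc_selfmap F -> Om X -> differentiable (F n) X.
Proof.
move=> Fself OmX.
have [s s0 s_ball] := ball_in OmX.
have [s3 s30 s3_ball] := ball_in (dsum_in (dsum_in OmX OmX) OmX).
have [s2 [K [s20 K0 s2_ball K_lip]]] := selfmap_lipschitz (dsum_in OmX OmX).
(* Halving passes from open balls to the closed balls of the previous section. *)
pose r := Num.min s (Num.min s2 s3) / 2.
have r0 : 0 < r by rewrite divr_gt0// !lt_min s0 s20.
have [rs [rs2 rs3]] : r < s /\ r < s2 /\ r < s3.
  have : r < Num.min s (Num.min s2 s3) by rewrite /r; move: r0; rewrite /r; lra.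
  by rewrite !lt_min => /and3P[].
have r_ball1 Y : nrm (Y - X) <= r -> Om Y.
  by move=> Yr; apply: s_ball; exact: le_lt_trans Yr rs.
have r_ball2 (Y : mtuple R d (n + n)) : nrm (Y - dsum X X) <= r -> Om Y.
  by move=> Yr; apply: s2_ball; exact: le_lt_trans Yr rs2.
have r_ball3 (Y : mtuple R d (n + n + n)) :
    nrm (Y - dsum (dsum X X) X) <= r -> Om Y.
  by move=> Yr; apply: s3_ball; exact: le_lt_trans Yr rs3.
have r_lip (Y Z : mtuple R d (n + n)) :
    nrm (Y - dsum X X) <= r -> nrm (Z - dsum X X) <= r ->
    nrm (F _ Y - F _ Z) <= K * nrm (Y - Z).
  move=> Yr Zr; apply: (K_lip _ Fself).
    exact: le_lt_trans Yr rs2.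
  exact: le_lt_trans Zr rs2.
pose L := nc_deriv F X r.
have L_lin : linear L by exact: nc_deriv_linear.
pose Llin := GRing.isLinear.Build C (mtuple R d n) (mtuple R d n) _ L L_lin.
pose L' : {linear mtuple R d n -> mtuple R d n} := HB.pack L Llin.
have L_cont : continuous L'.
  apply: bounded_linear_continuous; apply/ex_bound.
  exists ((M / r * 2)%:C : C); apply/nbhs_nrmP; exists 1 => // H.
  rewrite subr0 => H1 /=; rewrite nrmE (@lecR R).
  apply: le_trans (nc_deriv_bound Fself r0 r_ball2 H) _.
  by rewrite (ler_wpM2l (divr_ge0 M_ge0 (ltW r0)))//; lra.
apply: (@differentiable_of_error _ _ _ (F n) X L' L_cont) => e e0.
apply/nbhs_nrmP.
have er : (complex.Re e)%:C = e by apply/(@RRe_real R); rewrite gtr0_real.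
have e'0 : 0 < complex.Re e by rewrite -(@ltcR R) er.
have K1 : 0 < K + 1 by rewrite ltr_wpDl.
(* Within this radius [K / r * nrm H] is at most [e]; [K + 1] avoids dividing by zero. *)
exists (Num.min r (complex.Re e * r / (K + 1))).
    by rewrite lt_min r0 (divr_gt0 (mulr_gt0 e'0 r0) K1).
move=> H; rewrite subr0 lt_min => /andP[Hr He] /=.
rewrite (nrmE (_ - _)) (nrmE H) -er -rmorphM (@lecR R).
apply: le_trans (nc_deriv_error Fself OmX r0 r_ball2 r_ball3 K0 r_ball1 r_lip
  (ltW Hr)) _.
rewrite expr2 mulrA ler_wpM2r ?nrm_ge0//.
move: He; rewrite (ltr_pdivlMr _ _ K1) => He.
rewrite mulrAC (ler_pdivrMr _ _ r0); have := nrm_ge0 H; nra.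
Qed.

End SelfMaps.

(** * Pointwise limits of nc self-maps *)

Section Limits.
Local Open Scope complex_scope.
Local Open Scope sesquilinear_scope.
Variables (R : realType) (d : nat).
Local Notation C := (cplx R).
Local Notation coord := (@Defs.coord R d _).
Local Notation similar := (@Defs.similar R d _).
Local Notation mktuple := (@Defs.mktuple R d _).
Variables (U : set_system nat) (UF : ProperFilter U).

(** The filter is arbitrary: the given iterates converge along [\oo], the auxiliary ones along an
    ultrafilter. *)
Definition nrm_cvg p q (u : nat -> 'M[C]_(p, q)) (l : 'M[C]_(p, q)) :=
  forall e : R, 0 < e -> U [set k | nrm (u k - l) < e].

Lemma nrm_cvg_unique p q (u : nat -> 'M[C]_(p, q)) l l' :
  nrm_cvg u l -> nrm_cvg u l' -> l = l'.
Proof.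
move=> ul ul'; apply/eqP; rewrite -subr_eq0; apply/eqP/nrm0_eq0/eqP.
rewrite eq_le nrm_ge0 andbT leNgt; apply/negP => ll'.
have e0 : 0 < nrm (l - l') / 2 by rewrite divr_gt0.
have [k [/= kl kl']] := filter_ex (filterI (ul _ e0) (ul' _ e0)).
have : nrm (l - l') <= nrm (l - u k) + nrm (u k - l').
  by apply: le_trans (nrmD _ _); rewrite addrA subrK.
rewrite (nrmBC l (u k)) leNgt => /negP; apply.
by rewrite [ltRHS]splitr; exact: ltrD kl kl'.
Qed.

Lemma nrm_cvg_lipschitz p q p' q' (h : 'M[C]_(p, q) -> 'M[C]_(p', q'))
    (K : R) u l :
  (forall A, nrm (h A - h l) <= K * nrm (A - l)) ->
  nrm_cvg u l -> nrm_cvg (h \o u) (h l).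
Proof.
move=> hK ul e e0; have K1 : 0 < 1 + `|K| by rewrite ltr_wpDr.
apply: filterS (ul _ (divr_gt0 e0 K1)) => k /=; rewrite ltr_pdivlMr// => kl.
apply: le_lt_trans (hK _) _; apply: le_lt_trans kl.
by rewrite mulrC ler_wpM2l ?nrm_ge0//; have := ler_norm K; lra.
Qed.

Lemma nrm_sandwich p n q (P : 'M[C]_(p, n)) (A : 'M[C]_n) (Q : 'M[C]_(n, q)) :
  nrm (P *m A *m Q) <= n%:R * (n%:R * nrm P) * nrm Q * nrm A.
Proof.
apply: le_trans (nrmM _ _) _; rewrite [leRHS]mulrAC ler_wpM2r ?nrm_ge0//.
by rewrite -[leRHS]mulrA ler_wpM2l//; apply: nrmM.
Qed.

Lemma coord_mktupleB n (F G : 'I_d -> 'M[C]_n) k :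
  coord (mktuple F - mktuple G) k = F k - G k.
Proof. by rewrite coordB !mktupleK. Qed.

Lemma nrm_sandwichB p n (P : 'M[C]_(p, n)) (Q : 'M[C]_(n, p))
    (X Y : mtuple R d n) :
  nrm (mktuple (fun k => P *m coord X k *m Q) -
       mktuple (fun k => P *m coord Y k *m Q)) <=
  n%:R * (n%:R * nrm P) * nrm Q * nrm (X - Y).
Proof.
apply/tuple_leP => [|k]; first by rewrite !mulr_ge0 ?nrm_ge0.
rewrite coord_mktupleB -mulmxBl -mulmxBr -coordB.
apply: le_trans (nrm_sandwich _ _ _) _.
by rewrite ler_wpM2l ?coord_le_nrm// !mulr_ge0 ?nrm_ge0.
Qed.

Lemma nrm_cvg_dsum m n (u : nat -> mtuple R d m) (v : nat -> mtuple R d n) l l' :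
  nrm_cvg u l -> nrm_cvg v l' -> nrm_cvg (fun k => dsum (u k) (v k)) (dsum l l').
Proof.
move=> ul vl e e0; have e20 : 0 < e / 2 by rewrite divr_gt0.
apply: filterS (filterI (ul _ e20) (vl _ e20)) => k [/= ulk vlk].
apply: (@le_lt_trans _ _ (e / 2)); last lra.
rewrite -!utri0.
apply: nrm_utriB; rewrite ?(ltW e20) ?(ltW ulk) ?(ltW vlk)// => j.
by rewrite subrr nrm0 ltW.
Qed.

Variable Om : nc_subset R d.
Hypothesis Om_mcd : matrix_convex_domain Om.

(** Compression by the column of [a W] and [b], an isometry because [a ^+ 2 + b ^+ 2 = 1]. The sign
    of [b] is free, so the corner may enter with a negative weight. *)
Lemma compress_utri m n (W : 'M[C]_(n, m)) (a b : R) (X : mtuple R d n) H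
    (Y : mtuple R d m) : Defs.isometry W -> a ^+ 2 + b ^+ 2 = 1 -> (0 < m)%N ->
  Om (utri X H Y) ->
  Om (mktuple (fun k => ((a ^+ 2)%:C : C) *: (W ^t* *m coord X k *m W) +
    ((a * b)%:C : C) *: (W ^t* *m H k) + ((b ^+ 2)%:C : C) *: coord Y k)).
Proof.
move=> Wiso ab m0 OmT; case: Om_mcd => _ _ Oc.
pose V := col_mx ((a%:C : C) *: W) ((b%:C : C)%:M).
have VE : V ^t* = row_mx ((a%:C : C) *: W ^t*) ((b%:C : C)%:M).
  rewrite /V tr_col_mx map_row_mx linearZ/= map_mxZ tr_scalar_mx map_scalar_mx.
  by congr (row_mx (_ *: _) _%:M); apply/conj_Creal/complex_realP;
    [exists a|exists b].
have aa : (a%:C : C) * a%:C = (a ^+ 2)%:C by rewrite -rmorphM -expr2.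
have bb : (b%:C : C) * b%:C = (b ^+ 2)%:C by rewrite -rmorphM -expr2.
have Viso : Defs.isometry V.
  rewrite /Defs.isometry VE mul_row_col -scalemxAl -scalemxAr Wiso scalerA.
  by rewrite mul_scalar_mx !scale_scalar_mx mulr1 -raddfD/= aa bb -rmorphD ab.
have := Oc _ _ V _ m0 Viso OmT; congr (Om _); apply: eq_coord => k.
rewrite !mktupleK VE mul_row_block mul_row_col mulmx0 addr0.
rewrite -!scalemxAl -!scalemxAr scalerA aa.
rewrite mul_mx_scalar scalerDr mul_scalar_mx !scalerA bb.
have -> : (b%:C : C) * a%:C = (a * b)%:C by rewrite -rmorphM mulrC.
by rewrite addrA.
Qed.

Lemma compress_in m n (W : 'M[C]_(n, m)) (X : mtuple R d n) :
  Defs.isometry W -> (0 < m)%N -> Om X -> Om (compress W X).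
Proof. by case: Om_mcd => _ _ Oc Wiso m0 OmX; exact: Oc. Qed.

Lemma conv_in n (X Y : mtuple R d n) (a : R) : 0 <= a <= 1 -> Om X -> Om Y ->
  Om ((a%:C : C) *: X + ((1 - a)%:C : C) *: Y).
Proof.
move=> /andP[a0 a1] OmX OmY.
have iso1 : Defs.isometry (1%:M : 'M[C]_n).
  by rewrite /Defs.isometry trmx1 map_mx1 mulmx1.
have sqr_a : Num.sqrt a ^+ 2 = a by rewrite sqr_sqrtr.
have sqr_b : Num.sqrt (1 - a) ^+ 2 = 1 - a by rewrite sqr_sqrtr// subr_ge0.
have ab : Num.sqrt a ^+ 2 + Num.sqrt (1 - a) ^+ 2 = 1.
  by rewrite sqr_a sqr_b addrC subrK.
have OmT : Om (utri X (fun=> 0) Y) by rewrite utri0; exact: (dsum_in Om_mcd).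
have := compress_utri iso1 ab (Om_gt0 Om_mcd OmX) OmT; congr (Om _).
apply: eq_coord => k; rewrite mktupleK coordD !coordZ sqr_a sqr_b.
by rewrite trmx1 map_mx1 !(mul1mx, mulmx1) scaler0 addr0.
Qed.

Variables (F : nat -> nc_fun R d) (G : nc_fun R d).
Hypothesis Fself : forall k, nc_selfmap Om (F k).
Hypothesis FG : forall n (X : mtuple R d n), Om X ->
  nrm_cvg (fun k => F k X) (G X).

Lemma limit_nc_map : nc_map Om G.
Proof.
split=> [m n X Y OmX OmY|n S X Su OmX OmSX].
  apply: nrm_cvg_unique (FG (dsum_in Om_mcd OmX OmY)) _ => e e0.
  apply: filterS (nrm_cvg_dsum (FG OmX) (FG OmY) e0) => k /=.
  by have [[Fsum _] _] := Fself k; rewrite Fsum.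
have lip A : nrm (similar S A - similar S (G X)) <=
    n%:R * (n%:R * nrm (invmx S)) * nrm S * nrm (A - G X).
  exact: nrm_sandwichB.
apply: nrm_cvg_unique (FG OmSX) _ => e e0.
apply: filterS (nrm_cvg_lipschitz lip (FG OmX) e0) => k /=.
by have [[_ Fsim] _] := Fself k; rewrite Fsim.
Qed.

(* If [G X] is inside [Om], then [G Y] lies strictly between an interior point
   and a point of the closure of [Om m]: compressing
   [F (utri X (t (X W - W Y)) Y)] by a suitable isometry yields the point
   [F Y - e (W^* (F X) W - F Y)], i.e. the segment from [W^* (F X) W] to [F Y] can
   be extended beyond [F Y] by a fixed proportion. *)
Lemma limit_interior m n (X : mtuple R d n) (Y : mtuple R d m) :
  (m <= n)%N -> Om X -> Om Y -> Om (G X) -> Om (G Y).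
Proof.
move=> mn OmX OmY OmGX; have m0 := Om_gt0 Om_mcd OmY.
(* The coordinate inclusion, isometric because [m <= n]. *)
pose W : 'M[C]_(n, m) := pid_mx m.
have WE : W ^t* *m W = 1%:M.
  by rewrite /W tr_pid_mx map_pid_mx pid_mx_id// pid_mx_1.
pose D (k : 'I_d) := coord X k *m W - W *m coord Y k.
pose N : R := \sum_k nrm (D k).
have N0 : 0 <= N by apply: sumr_ge0 => k _; exact: nrm_ge0.
have DN k : nrm (D k) <= N.
  by rewrite /N (bigD1 k)//= lerDl; apply: sumr_ge0 => j _; exact: nrm_ge0.
have [s s0 s_ball] := ball_in Om_mcd (dsum_in Om_mcd OmX OmY).
pose t := s / 2 / (1 + N).
have t0 : 0 < t by rewrite !divr_gt0// ltr_wpDr.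
pose Gt : 'M[C]_(n, m) := (t%:C : C) *: W.
have GtE (A : mtuple R d n) (B : mtuple R d m) k :
    coord A k *m Gt - Gt *m coord B k =
    (t%:C : C) *: (coord A k *m W - W *m coord B k).
  by rewrite /Gt -scalemxAr -scalemxAl scalerBr.
have OmT : Om (utri X (fun k => coord X k *m Gt - Gt *m coord Y k) Y).
  apply: s_ball; rewrite -utri0; apply: (@le_lt_trans _ _ (s / 2)); last lra.
  apply: nrm_utriB; rewrite ?subrr ?nrm0 ?divr_ge0 ?(ltW s0)// => k.
  rewrite subr0 GtE nrmZr gtr0_norm// /t mulrAC ler_pdivrMr ?ltr_wpDr//.
  by rewrite ler_wpM2l ?divr_ge0 ?(ltW s0)//; have := DN k; rewrite /D; lra.
(* With [c ^+ 2 = e] and [b = - (2 / t * c)] the cross term [c * b * t] is [- (2 * e)], turning the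
   weight of the compressed [F k X] from [e] into [- e]; then [c ^+ 2 + b ^+ 2 = 1] forces this [e],
   the same for all [k]. *)
have [e eE] : exists e, e = t ^+ 2 / (t ^+ 2 + 4) by eexists.
have t4 : 0 < t ^+ 2 + 4 by rewrite ltr_wpDl ?sqr_ge0.
have e0 : 0 < e by rewrite eE divr_gt0// exprn_gt0.
have e10 : 0 < (1 + e) / e by rewrite divr_gt0// ltr_wpDl.
have e1 : 1 + e != 0 by rewrite gt_eqF// ltr_wpDl.
pose c := Num.sqrt e; have c2 : c ^+ 2 = e by rewrite sqr_sqrtr// ltW.
pose b := - (2 / t * c).
have b2 : b ^+ 2 = 1 - e.
  by rewrite /b sqrrN exprMn c2 eE; field; rewrite !gt_eqF.
have cb : c ^+ 2 + b ^+ 2 = 1 by rewrite b2 c2 addrC subrK.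
have cbt : c * b * t = - (2 * e).
  by rewrite /b -c2; field; rewrite gt_eqF.
pose Ck k : mtuple R d m := ((1 + e)%:C : C) *: F k Y -
  (e%:C : C) *: compress W (F k X).
have OmC k : Om (Ck k).
  have [_ FOm] := Fself k.
  have := FOm _ _ OmT; rewrite (selfmap_utri Om_mcd (Fself k) OmX OmY OmT).
  move=> /(compress_utri WE cb m0); congr (Om _); apply: eq_coord => j.
  rewrite /Ck mktupleK GtE coordB !coordZ mktupleK.
  rewrite c2 b2 -scalemxAr scalerA -rmorphM cbt mulmxBr !mulmxA WE mul1mx.
  have alg (P Q : 'M[C]_m) : (e%:C : C) *: P + ((- (2 * e))%:C : C) *: (P - Q) +
      ((1 - e)%:C : C) *: Q = ((1 + e)%:C : C) *: Q - (e%:C : C) *: P.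
    apply/matrixP => i l; rewrite !mxE.
    rewrite !(rmorphD, rmorphN, rmorphM, rmorph1, rmorphMn)/=; ring.
  exact: alg.
(* Chosen so that [G Y] is exactly a convex combination of [Ck k] and [A' k]. As [A' k] tends to
   [compress W (G X)], some [A' k] lies in the open set [Om m]. *)
pose A' k : mtuple R d m := compress W (F k X) +
  (((1 + e) / e)%:C : C) *: (G Y - F k Y).
have OmD : Om (compress W (G X)) by exact: compress_in.
have [r r0 r_ball] := ball_in Om_mcd OmD.
have r20 : 0 < r / 2 by rewrite divr_gt0.
have lip A : nrm (compress W A - compress W (G X)) <=
    n%:R * (n%:R * nrm (W ^t* )) * nrm W * nrm (A - G X).
  exact: nrm_sandwichB.
have A'D : U [set k | nrm (A' k - compress W (G X)) < r].
  have r'0 : 0 < r / 2 * e / (1 + e) by rewrite divr_gt0 ?mulr_gt0// ltr_wpDl.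
  apply: filterS (filterI (nrm_cvg_lipschitz lip (FG OmX) r20) (FG OmY r'0)).
  move=> k [/= kX kY]; rewrite /A' addrAC [ltRHS]splitr.
  apply: le_lt_trans (nrmD _ _) (ltrD kX _).
  rewrite nrmZr gtr0_norm// nrmBC mulrC -ltr_pdivlMr//.
  by rewrite invf_div mulrA.
have [k /= kr] := filter_ex A'D.
have -> : G Y = (((1 + e)^-1)%:C : C) *: Ck k + ((1 - (1 + e)^-1)%:C : C) *: A' k.
  have r1 : (1 + e)^-1 * (1 + e) = 1 by rewrite mulVf.
  have r2 : (1 - (1 + e)^-1) * ((1 + e) / e) = 1.
    by field; rewrite e1 gt_eqF.
  have r3 : (1 + e)^-1 * e = 1 - (1 + e)^-1 by field.
  rewrite /Ck /A' scalerBr scalerDr !scalerA -!rmorphM/= r1 r2 r3 !scale1r.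
  by rewrite addrA subrK addrC subrK.
apply: conv_in; [|exact: OmC|exact: r_ball].
by rewrite invr_ge0 invf_le1; lra.
Qed.

End Limits.

(** * Limits of bounded sequences along an ultrafilter *)

Section Compactness.
Local Open Scope complex_scope.
Variables (R : realType).
Local Notation C := (cplx R).
Variables (U : set_system nat) (UU : UltraFilter U).

(** Compactness of the segment gives a cluster point, and an ultrafilter converges to it: otherwise
    it would contain the complement of a ball around it. *)
Lemma ultra_bounded_cvg (u : nat -> R) (M : R) : (forall k, `|u k| <= M) ->
  exists l, forall e, 0 < e -> U [set k | `|u k - l| < e].
Proof.
move=> uM; have := @segment_compact R (- M) M.
have uU : (u @ U) `[- M, M]%classic.
  suff : U (u @^-1` `[- M, M]%classic) by [].
  apply: (@filterS _ U _ setT); last exact: filterT.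
  by move=> k _ /=; rewrite in_itv/= -ler_norml uM.
move=> /(_ _ _ uU)[l [_ ul]]; exists l => e e0.
have [//|notU] := in_ultra_setVsetC [set k | `|u k - l| < e] UU.
have uV : (u @ U) (~` ball l e).
  suff : U (u @^-1` (~` ball l e)) by [].
  by apply: filterS notU => k /= kl; rewrite /ball/= distrC.
by have [x [xl]] := ul _ _ uV (nbhsx_ballx l _ e0).
Qed.

Lemma ultra_nrm_cvg p q (u : nat -> 'M[C]_(p, q)) (M : R) :
  (forall k, nrm (u k) <= M) -> exists l, nrm_cvg U u l.
Proof.
move=> uM.
have entry i j : exists l : C, forall e : R, 0 < e ->
    U [set k | Normc.normc (u k i j - l) < e].
  have reM k : `|complex.Re (u k i j)| <= M.
    apply: le_trans (uM k); apply: le_trans (entry_le_nrm (u k) i j).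
    by have := normc_ge_Re (u k i j); rewrite (@lecR R).
  have imM k : `|complex.Im (u k i j)| <= M.
    apply: le_trans (uM k); apply: le_trans (entry_le_nrm (u k) i j).
    case: (u k i j) => a b /=; rewrite -sqrtr_sqr ler_wsqrtr// lerDr sqr_ge0//.
  have [a ua] := ultra_bounded_cvg reM; have [b ub] := ultra_bounded_cvg imM.
  exists (a +i* b) => e e0; have e20 : 0 < e / 2 by rewrite divr_gt0.
  apply: filterS (filterI (ua _ e20) (ub _ e20)) => k [/=].
  case: (u k i j) => x y /= xa yb; rewrite [ltRHS]splitr.
  apply: le_lt_trans (ltrD xa yb).
  suff : Normc.normc ((x - a) +i* (y - b)) <= `|x - a| + `|y - b| by [].
  have -> : (x - a) +i* (y - b) = (x - a)%:C + 0 +i* (y - b).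
    by simpc.
  apply: le_trans (le_normcD _ _) _.
  by rewrite /= !expr0n/= addr0 add0r !sqrtr_sqr.
have [l ul] : exists l : 'M[C]_(p, q), forall i j (e : R), 0 < e ->
    U [set k | Normc.normc (u k i j - l i j) < e].
  pose S i j := [set z : C | forall e : R, 0 < e ->
    U [set k | Normc.normc (u k i j - z) < e]].
  exists (\matrix_(i, j) xget 0 (S i j)) => i j e e0; rewrite mxE.
  by have [z uz] := entry i j; exact: (xgetI 0 (uz : S i j z)).
exists l => e e0; have e20 : 0 < e / 2 by rewrite divr_gt0.
have Uall : U [set k | forall ij : 'I_p * 'I_q,
    Normc.normc (u k ij.1 ij.2 - l ij.1 ij.2) < e / 2].
  apply: (@filter_forall _ _ (fun ij =>
    [set k | Normc.normc (u k ij.1 ij.2 - l ij.1 ij.2) < e / 2])) => ij.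
  exact: ul.
apply: filterS Uall => k /= uk.
apply: (@le_lt_trans _ _ (e / 2)); last lra.
apply/nrm_leP => [|i j]; first exact: ltW.
by rewrite !mxE; apply: ltW; exact: (uk (i, j)).
Qed.

End Compactness.

Lemma nrm_cvg_eq (R : realType) (U : set_system nat) p q
    (u v : nat -> 'M[cplx R]_(p, q)) l :
  u =1 v -> nrm_cvg U u l -> nrm_cvg U v l.
Proof. by move/funext ->. Qed.

(** * Iterates *)

Section Iterates.
Variables (R : realType) (d : nat).
Local Notation C := (cplx R).
Variables (Om : nc_subset R d) (M : R).
Hypothesis Om_mcd : matrix_convex_domain Om.
Hypothesis M_ge0 : 0 <= M.
Hypothesis Om_le : forall n (X : mtuple R d n), Om X -> nrm X <= M.

Section LimitMaps.
Variables (U : set_system nat) (UF : ProperFilter U).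
Variables (F : nat -> nc_fun R d) (G : nc_fun R d).
Hypothesis Fself : forall k, nc_selfmap Om (F k).
Hypothesis FG : forall n (X : mtuple R d n), Om X ->
  nrm_cvg U (fun k => F k X) (G X).

(** [limit_interior] reaches only levels up to that of its base point; replacing [Z] by [dsum Z Z],
    which [G] also keeps in [Om], raises the level without bound. *)
Lemma limit_selfmap n (X : mtuple R d n) : Om X -> Om (G X) -> nc_selfmap Om G.
Proof.
move=> OmX OmGX; have Gnc := limit_nc_map UF Om_mcd Fself FG.
have [Gsum _] := Gnc; split=> // m Y OmY.
have [p [Z [mp OmZ OmGZ]]] : exists p (Z : mtuple R d p),
    [/\ (m <= p)%N, Om Z & Om (G Z)].
  elim: {OmY Y} m => [|m [p [Z [mp OmZ OmGZ]]]]; first by exists n, X; split.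
  exists (p + p)%N, (dsum Z Z); split.
  - by have := Om_gt0 Om_mcd OmZ; move: mp; clear; lia.
  - exact: (dsum_in Om_mcd OmZ OmZ).
  - by rewrite Gsum//; exact: (dsum_in Om_mcd OmGZ OmGZ).
exact: (limit_interior UF Om_mcd Fself FG mp OmZ OmY OmGZ).
Qed.

(** All [F k] share one Lipschitz constant near [Z], so [F k (u k)] and [F k Z] have the same
    limit. *)
Lemma limit_comp n (u : nat -> mtuple R d n) (Z : mtuple R d n) : Om Z ->
  nrm_cvg U u Z -> nrm_cvg U (fun k => F k (u k)) (G Z).
Proof.
move=> OmZ uZ e e0.
have [r [K [r0 K0 _ lip]]] := selfmap_lipschitz Om_mcd M_ge0 Om_le OmZ.
have K1 : 0 < K + 1 by rewrite ltr_wpDl.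
have e20 : 0 < e / 2 by rewrite divr_gt0.
have UFZ := FG OmZ e20.
have UuZ := uZ _ (divr_gt0 e20 K1).
apply: filterS (filterI UFZ (filterI (uZ _ r0) UuZ)) => k [/= FZ [ur uK]].
have -> : F k (u k) - G Z = (F k Z - G Z) + (F k (u k) - F k Z).
  by rewrite [RHS]addrC addrA subrK.
rewrite [ltRHS]splitr; apply: le_lt_trans (nrmD _ _) (ltrD FZ _).
have ZZ : nrm (Z - Z) < r by rewrite subrr nrm0.
apply: le_lt_trans (lip _ (Fself k) _ _ ur ZZ) _.
move: uK; rewrite ltr_pdivlMr// mulrDr mulr1 mulrC.
by apply: le_lt_trans; rewrite lerDl nrm_ge0.
Qed.

End LimitMaps.

Lemma limit_exists (U : set_system nat) (F : nat -> nc_fun R d) :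
  UltraFilter U -> (forall k, nc_selfmap Om (F k)) ->
  exists G : nc_fun R d, forall n (X : mtuple R d n), Om X ->
    nrm_cvg U (fun k => F k n X) (G n X).
Proof.
move=> UU Fself.
exists (fun n X => xget 0 [set L | nrm_cvg U (fun k => F k n X) L]) => n X OmX.
have FM k : nrm (F k n X) <= M by apply: Om_le; apply: (Fself k).2.
by have [L FL] := ultra_nrm_cvg UU FM; exact: (xgetI 0 FL).
Qed.

Variables (f g : nc_fun R d) (nk : nat -> nat).
Hypothesis fself : nc_selfmap Om f.
Hypothesis nk_incr : {homo nk : i j / (i < j)%N}.
Hypothesis fg : forall n (X : mtuple R d n), Om X ->
  nrm_cvg \oo (fun k => iter (nk k) (@f n) X) (g X).

Let fn j : nc_fun R d := fun n => iter j (@f n).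

(* With [s k = 2 n_k + k] the three exponents [n_(s k) - n_k], [n_(s k) - 2 n_k]
   and [n_k] add up to give, in the limit, [psi o g = g], [h o g = psi]. *)
Lemma limit_retraction n0 (X0 : mtuple R d n0) : Om X0 -> Om (g X0) ->
  exists psi h : nc_fun R d,
  [/\ nc_selfmap Om g, nc_selfmap Om psi, nc_selfmap Om h &
   forall n (X : mtuple R d n), Om X ->
    [/\ psi n (g X) = g X, g (psi n X) = g X, g (h n X) = psi n X,
        h n (g X) = psi n X & psi n (h n X) = h n (psi n X)]].
Proof.
move=> OmX0 OmgX0.
have [U [UU ooU]] := ultraFilterLemma (@eventually_filter).
pose s k := (2 * nk k + k)%N.
have nk_ge k : (k <= nk k)%N.
  elim: k => // k IH; exact: leq_ltn_trans IH (nk_incr (ltnSn k)).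
have fnself j : nc_selfmap Om (fn j) by exact: iter_selfmap.
pose Fm k := fn (nk (s k) - nk k); pose Fq k := fn (nk (s k) - 2 * nk k).
have [psi psiE] := limit_exists (F := Fm) UU (fun k => fnself _).
have [h hE] := limit_exists (F := Fq) UU (fun k => fnself _).
have gE n (X : mtuple R d n) : Om X -> nrm_cvg U (fun k => fn (nk k) X) (g X).
  by move=> OmX e e0; apply: ooU; exact: fg.
have gsE n (X : mtuple R d n) : Om X ->
    nrm_cvg U (fun k => fn (nk (s k)) X) (g X).
  move=> OmX e e0; apply: ooU; have [N _ NP] := fg OmX e0.
  exists N => // k /= Nk; apply: NP => /=; rewrite /s; move: Nk; clear; lia.
(* Makes the truncated subtractions in [Fm] and [Fq] genuine. *)
have nks k : (2 * nk k <= nk (s k))%N.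
  have := nk_ge (s k); rewrite /s; clear; lia.
have UF : ProperFilter U by exact: ultra_proper.
have gself := limit_selfmap UF (fun k => fnself _) gE OmX0 OmgX0.
have gOm n (X : mtuple R d n) : Om X -> Om (g X) by exact: gself.2.
have psiself0 n (X : mtuple R d n) : Om X -> psi n (g X) = g X.
  move=> OmX; have OmgX := gOm _ _ OmX.
  have FE k : Fm k n (fn (nk k) X) = fn (nk (s k)) X.
    rewrite /Fm /fn -iterD subnK//; have := nks k; clear; lia.
  have := limit_comp UF (fun k => fnself _) psiE OmgX (gE _ _ OmX).
  by move/(nrm_cvg_eq FE)/nrm_cvg_unique; apply; exact: gsE.
(* [limit_selfmap] asks for one point kept in [Om]: [psi] fixes [g X0], and below [h] sends [g X0]
   to [psi X0]. *)
have OmggX0 : Om (psi n0 (g X0)) by rewrite psiself0.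
have psiself := limit_selfmap UF (fun k => fnself _) psiE OmgX0 OmggX0.
have psiOm n (X : mtuple R d n) : Om X -> Om (psi n X) by exact: psiself.2.
have hg n (X : mtuple R d n) : Om X -> h n (g X) = psi n X.
  move=> OmX; have OmgX := gOm _ _ OmX.
  have FE k : Fq k n (fn (nk k) X) = Fm k n X.
    rewrite /Fm /Fq /fn -iterD; congr (iter _ _ _).
    have := nks k; clear; lia.
  have := limit_comp UF (fun k => fnself _) hE OmgX (gE _ _ OmX).
  by move/(nrm_cvg_eq FE)/nrm_cvg_unique; apply; exact: psiE.
have OmhgX0 : Om (h n0 (g X0)) by rewrite hg//; exact: psiOm.
have hself := limit_selfmap UF (fun k => fnself _) hE OmgX0 OmhgX0.
have hOm n (X : mtuple R d n) : Om X -> Om (h n X) by exact: hself.2.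
exists psi, h; split=> // n X OmX; split.
- exact: psiself0.
- have FE k : fn (nk k) (Fm k n X) = fn (nk (s k)) X.
    rewrite /Fm /fn -iterD; congr (iter _ _ _); have := nks k; clear; lia.
  have := limit_comp UF (fun k => fnself _) gE (psiOm _ _ OmX) (psiE _ _ OmX).
  by move/(nrm_cvg_eq FE)/nrm_cvg_unique; apply; exact: gsE.
- have FE k : fn (nk k) (Fq k n X) = Fm k n X.
    rewrite /Fm /Fq /fn -iterD; congr (iter _ _ _); have := nks k; clear; lia.
  have := limit_comp UF (fun k => fnself _) gE (hOm _ _ OmX) (hE _ _ OmX).
  by move/(nrm_cvg_eq FE)/nrm_cvg_unique; apply; exact: psiE.
- exact: hg.
(* Iterates of [f] commute, and the limits of both composites exist. *)
- have FE k : Fm k n (Fq k n X) = Fq k n (Fm k n X).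
    by rewrite /Fm /Fq /fn -!iterD addnC.
  have := limit_comp UF (fun k => fnself _) psiE (hOm _ _ OmX) (hE _ _ OmX).
  move/(nrm_cvg_eq FE)/nrm_cvg_unique; apply.
  exact: (limit_comp UF (fun k => fnself _) hE (psiOm _ _ OmX) (psiE _ _ OmX)).
Qed.

End Iterates.

(** * Fixed-point sets as subvarieties, and the dichotomy *)

Lemma mxvec_continuous (R : realType) p q :
  continuous (mxvec : 'M[cplx R]_(p, q) -> 'rV[cplx R]_(p * q)).
Proof.
apply: bounded_linear_continuous; apply/ex_bound.
exists (real_complex R 1 : cplx R); apply/nbhs_nrmP; exists 1 => // A.
rewrite subr0 => /ltW /nrm_leP A1 /=; rewrite nrmE (@lecR R).
apply/nrm_leP => // i j; rewrite (ord1 i); case/mxvec_indexP: j => k l.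
by rewrite mxvecE; exact: A1.
Qed.

(** One neighbourhood, [W] itself, serves all points: the equations are the entries of [h Y - Y],
    flattened into a row. *)
Lemma fixed_points_analytic (R : realType) p q (W : set 'M[cplx R]_(p, q))
    (h : 'M[cplx R]_(p, q) -> 'M[cplx R]_(p, q)) :
  open W -> holomorphic W h -> analytic_subvariety W [set X | W X /\ h X = X].
Proof.
move=> Wo hW; split=> [X []//|X WX].
exists W, (p * q)%N, (mxvec \o (fun Y => h Y - Y)); split=> //.
  move=> Y WY; apply: differentiable_comp.
    by apply: differentiableB; [exact: hW|exact: ex_diff].
  by apply: linear_differentiable; exact: mxvec_continuous.
apply/seteqP; split=> Y /= [].
  by move=> [WY hY] _; split; rewrite // hY subrr linear0.
move=> WY /eqP; rewrite mxvec_eq0 subr_eq0 => /eqP hY.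
by split.
Qed.

Theorem theorem5p4 (R : realType) (d : nat) (Om : nc_subset R d)
    (f g : nc_fun R d) (nk : nat -> nat) :
  matrix_convex_domain Om ->
  uniformly_bounded Om ->
  nc_map Om f ->
  (forall n, set_fun (Om n) (Om n) (f n)) ->
  {homo nk : i j / (i < j)%N} ->
  (forall n (K : set (mtuple R d n)), K `<=` Om n -> compact K ->
     {uniform K, (fun k => iter (nk k) (f n)) @ \oo --> g n}) ->
  (forall n, (0 < n)%N -> g n @` Om n `<=` boundary (Om n)) \/
  (exists (V : nc_subset R d) (phi psi : nc_fun R d),
     [/\ nc_analytic_subvariety Om V,
         nc_automorphism V phi,
         nc_retraction Om V psi &
         forall n X, Om n X -> g n X = phi n (psi n X)]).
Proof.
move=> Om_mcd /uniformly_bounded_nrm[M M_ge0 Om_le] fnc fOm nk_incr fg.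
have [[Om0 Osum] Om_open _] := Om_mcd.
have fself : nc_selfmap Om f by split.
have fgX n (X : mtuple R d n) : Om n X ->
    nrm_cvg \oo (fun k => iter (nk k) (f n) X) (g n X).
  move=> OmX e e0.
  (* A singleton is compact, which yields pointwise convergence. *)
  have XOm : [set X] `<=` Om n by move=> _ ->.
  have := fg n _ XOm (@compact_set1 _ X).
  rewrite uniform_set1 => fgX.
  have gB : nbhs (g n X) [set Y | nrm (Y - g n X) < e].
    by apply/nbhs_nrmP; exists e.
  exact: fgX _ gB.
have [[n0 [X0 [OmX0 OmgX0]]]|bd] :=
  pselect (exists n (X : mtuple R d n), Om n X /\ Om n (g n X)); [right|left].
  have [psi [h [gself psiself hself gE]]] :=
    limit_retraction Om_mcd M_ge0 Om_le fself nk_incr fgX OmX0 OmgX0.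
  pose V : nc_subset R d := fun n => [set X | Om n X /\ psi n X = X].
  have hol F n : nc_selfmap Om F -> holomorphic (Om n) (F n).
    move=> Fself X OmX.
    exact: (selfmap_differentiable Om_mcd M_ge0 Om_le Fself OmX).
  have ncV F : nc_selfmap Om F -> nc_map V F.
    move=> [[Fsum Fsim] _]; split=> [m n X Y [OmX _] [OmY _]|].
      exact: Fsum.
    by move=> n S X Su [OmX _] [OmSX _]; exact: Fsim.
  have holV F n : nc_selfmap Om F -> holomorphic_on (V n) (F n).
    move=> Fself X [OmX _]; exists (Om n), (F n); split=> //.
      exact: Om_open.
    exact: hol.
  have gV n X : V n X -> V n (g n X).
    by move=> [OmX _]; split; [exact: gself.2|have [] := gE n X OmX].
  have hV n X : V n X -> V n (h n X).
    move=> [OmX pX]; split; first exact: hself.2.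
    by have [_ _ _ _ ->] := gE n X OmX; rewrite pX.
  have gh n X : V n X -> g n (h n X) = X.
    by move=> [OmX pX]; have [_ _ -> _ _] := gE n X OmX.
  have hg n X : V n X -> h n (g n X) = X.
    by move=> [OmX pX]; have [_ _ _ -> _] := gE n X OmX.
  have psiV n X : Om n X -> V n (psi n X).
    move=> OmX; split; first exact: psiself.2.
    (* [psi X] equals [g (h X)], and [psi] fixes the values of [g]. *)
    have [_ _ <- _ _] := gE n X OmX.
    by have [-> _ _ _ _] := gE n (h n X) (hself.2 _ _ OmX).
  exists V, g, psi; split.
  - split=> [|n]; last first.
      by apply: fixed_points_analytic; [exact: Om_open|exact: hol].
    split=> [|m n X Y [OmX pX] [OmY pY]].
      by apply/seteqP; split=> // X []; rewrite Om0.
    by split; [exact: Osum|have [[psum _] _] := psiself; rewrite psum// pX pY].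
  - exists h; split=> [n|n X VX| |].
    + split; first by move=> X; exact: gV.
        move=> X Y /set_mem VX /set_mem VY XY.
        by rewrite -(hg n X VX) XY hg.
      by move=> X VX; exists (h n X); [exact: hV|exact: gh].
    + by split; [exact: hV|exact: gh].
    + by split; [exact: ncV|move=> n; exact: holV].
    + by split; [exact: ncV|move=> n; exact: holV].
  - split; first by case: psiself.
    + by move=> n; exact: hol.
    + move=> n; apply/seteqP; split=> [_ [X OmX <-]|X [OmX pX]].
        exact: psiV.
      by exists X.
    + by move=> n X [].
  - by move=> n X OmX; have [_ -> _ _ _] := gE n X OmX.
(* Values of [g] are limits of iterates, which stay in [Om], hence lie in the closure; an interior
   value would be a point of [Om], contradicting [bd]. *)
move=> n n0 _ [X OmX <-]; split.
  move=> B /nbhs_nrmP[r r0 rB].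
  have [k /= kr] := filter_ex (fgX n X OmX r r0).
  exists (iter (nk k) (f n) X); split; last exact: rB.
  exact: (iter_selfmap (nk k) fself).2.
by move/interior_subset => OmgX; apply: bd; exists n, X.
Qed.
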